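(* Let $U$ be a finite set of combinatorial rules. Run the following procedure on $U$: as long as there is a rule $\mathcal{A} \xleftarrow{S} (\mathcal{B}^{(1)},\ldots,\mathcal{B}^{(m)})$ in the current set such that some $\mathcal{B}^{(j)}$ is not the left-hand side of any rule in the current set, remove that rule from the current set; stop when no rule can be removed, and let $V$ be the resulting set. Then $V$ is equal to the union of all subsets $U' \subseteq U$ that are combinatorial specifications.
   Context: A combinatorial set is a set of objects, each assigned a size in $\mathbb{N}=\{0,1,2,\ldots\}$, with only finitely many objects of each size. A combinatorial rule is a triple written $\mathcal{A} \xleftarrow{S} (\mathcal{B}^{(1)},\ldots,\mathcal{B}^{(m)})$ with $m\ge 0$, where $\mathcal{A}$ (the left-hand side) and $\mathcal{B}^{(1)},\ldots,\mathcal{B}^{(m)}$ (the sets on the right-hand side) are combinatorial sets and $S$ is a label (a strategy); rules with $m=0$ have empty right-hand side. A combinatorial specification is a set of combinatorial rules with the property that every combinatorial set appearing on the right-hand side of some rule in it appears as the left-hand side of exactly one rule in it. *)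

(* Defs.v *)
From HB Require Import structures.
From Stdlib Require Export Relation_Operators.
From mathcomp Require Export all_boot.
From mathcomp Require Export boolp classical_sets functions cardinality.

Set Implicit Arguments.
Unset Strict Implicit.
Unset Printing Implicit Defensive.

Local Open Scope classical_set_scope.

(* The size is only defined on the members of the set, so that Leibniz equality
   of combinatorial sets is equality of the underlying sets together with
   their size functions. *)
Record combSet (T : Type) := CombSet {
  objects :> set T;
  osize : objects -> nat;
  osize_finite : forall n : nat, finite_set [set x | osize x = n]
}.

HB.instance Definition _ (T : Type) := gen_eqMixin (combSet T).
HB.instance Definition _ (T : Type) := gen_choiceMixin (combSet T).

Record combRule (T L : Type) := CombRule {
  lhs : combSet T;
  strategy : L;
  rhs : seq (combSet T)
}.

Section Procedure.
Variables T L : Type.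
Implicit Types (U V W : set (combRule T L)) (r : combRule T L).

Definition is_specification W : Prop :=
  forall r B, W r -> B \in rhs r -> exists! r', W r' /\ lhs r' = B.

Definition removable W r : Prop :=
  W r /\ exists2 B, B \in rhs r & forall r', W r' -> lhs r' <> B.

Definition prune_step W W' : Prop :=
  exists2 r, removable W r & W' = W `\ r.

(* The choice of the rule to remove is left open, so the procedure is a
   relation; V is a possible outcome of a run on U. *)
Definition prune_result U V : Prop :=
  clos_refl_trans _ prune_step U V /\ forall r, ~ removable V r.

(* There is no infinite run starting from U. *)
Definition prune_terminates U : Prop :=
  Acc (fun W' W => prune_step W W') U.

End Procedure.

(* Main.v *)
From HB Require Import structures.
Require Import Defs.

Local Open Scope classical_set_scope.

(** A specification contained in the current set never loses a rule, since every
    right-hand side of its rules is still a left-hand side in the current set;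
    so all specifications survive in [V]. Conversely every right-hand side in
    [V] is a left-hand side in [V], and choosing one rule of [V] for each
    left-hand side, with a given [r] chosen for [lhs r], yields a specification
    containing [r]. *)

HB.instance Definition _ (T L : Type) := gen_eqMixin (combRule T L).
HB.instance Definition _ (T L : Type) := gen_choiceMixin (combRule T L).

Section Pruning.
Set Implicit Arguments.
Unset Strict Implicit.
Variables T L : Type.
Implicit Types (U V W : set (combRule T L)) (r : combRule T L).

(** Induction on the length of a list covering [W], possibly with repetitions or extra entries:
    dropping every copy of the removed rule gives a shorter list that covers what remains. *)
Lemma prune_terminates_seq (s : seq (combRule T L)) W :
  W `<=` [set` s] -> prune_terminates W.
Proof.
have [n] := ubnP (size s); elim: n s W => [|n IHn] s W; first by rewrite ltn0.
move=> les Ws; constructor=> W' [r [Wr _] ->].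
apply: (IHn [seq x <- s | x != r]); last first.
  by move=> x [Wx /eqP xr] /=; rewrite mem_filter xr; exact: Ws.
rewrite -ltnS; apply: leq_trans les; rewrite !ltnS size_filter.
rewrite -(count_predC (pred1 r) s) -[X in (X < _)%N]add0n ltn_add2r.
by rewrite -has_count has_pred1; exact: Ws.
Qed.

Lemma finite_prune_terminates U : finite_set U -> prune_terminates U.
Proof. by move=> /finite_seqP[s ->]; exact: (@prune_terminates_seq s). Qed.

Lemma prune_sub U V : clos_refl_trans _ (@prune_step T L) U V -> V `<=` U.
Proof.
elim=> {U V} [U _ [r _ ->]|U|U V W _ VU _ WV].
- by move=> x [].
- exact: subset_refl.
- exact: subset_trans WV VU.
Qed.

Lemma specification_sub_prune W U V : is_specification W ->
  clos_refl_trans _ (@prune_step T L) U V -> W `<=` U -> W `<=` V.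
Proof.
move=> specW; elim=> {U V} [U _ [r [_ [B rB noB]] ->] WU x Wx|//|U V X _ IH1 _ IH2 WU].
  split; first exact: WU.
  move=> xr; rewrite xr in Wx.
  by have [r' [[Wr' r'B] _]] := specW _ _ Wx rB; exact: (noB r' (WU _ Wr')).
exact/IH2/IH1.
Qed.

Lemma unremovable_specification V r : (forall r', ~ removable V r') -> V r ->
  exists W, [/\ W `<=` V, is_specification W & W r].
Proof.
move=> stuck Vr.
(* The last clause forces [f (lhs r) = r], which puts [r] among the chosen rules. *)
have [f fP] : {f : combSet T -> combRule T L &
    forall B, (exists2 r', V r' & lhs r' = B) ->
      [/\ V (f B), lhs (f B) = B & B = lhs r -> f B = r]}.
  apply: (@choice _ _ (fun B x => (exists2 r', V r' & lhs r' = B) ->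
      [/\ V x, lhs x = B & B = lhs r -> x = r])) => B.
  have [->|Br] := pselect (B = lhs r); first by exists r.
  have [[r' Vr' r'B]|noB] := pselect (exists2 r', V r' & lhs r' = B).
    by exists r'; split=> // /Br.
  (* Off the left-hand sides of [V] the condition is vacuous, and [r] is a mere default value. *)
  by exists r => /noB.
have imV B : (exists2 r', V r' & lhs r' = B) -> lhs (f B) = B by case/fP.
exists (f @` [set B | exists2 r', V r' & lhs r' = B]); split.
- by move=> _ [B /fP[VfB _ _] <-].
- move=> _ B [C /fP[VfC _ _] <-] CB.
  have VB : exists2 r', V r' & lhs r' = B.
    (* Otherwise [f C], a rule of [V] with [B] on its right-hand side, would be removable. *)
    apply: contrapT => noB; apply: (stuck (f C)); split=> //; exists B => //.
    by move=> r' Vr' r'B; apply: noB; exists r'.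
  exists (f B); split; first by split; [exists B|exact: imV].
  (* Uniqueness: a chosen rule [f D] has left-hand side [D], so [lhs (f D) = B] forces [D = B]. *)
  by move=> _ [[D VD <-] <-]; rewrite imV.
- have Vl : exists2 r', V r' & lhs r' = lhs r by exists r.
  by exists (lhs r) => //; case: (fP _ Vl) => _ _; exact.
Qed.

End Pruning.

Theorem theorem3p7 (T L : Type) (U : set (combRule T L)) (finU : finite_set U) :
  prune_terminates U /\
  forall V : set (combRule T L), prune_result U V ->
    V = \bigcup_(U' in [set W | W `<=` U /\ is_specification W]) U'.
Proof.
split=> [|V [UV stuck]]; first exact: finite_prune_terminates.
apply/seteqP; split=> [r Vr|r [W [WU specW] Wr]].
  have [W [WV specW Wr]] := unremovable_specification stuck Vr.
  by exists W => //; split=> //; exact: subset_trans WV (prune_sub UV).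
exact: specification_sub_prune specW UV WU _ Wr.
Qed.
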